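(* Any finitely presented, residually finite, amenable group has non-positive rank gradient.
   Context: For a finitely generated group $H$, $d(H)$ denotes the minimal size of a generating set of $H$. The rank gradient of a finitely generated group $G$ is $\inf_{N} \frac{d(N)-1}{[G:N]}$, where $N$ ranges over all finite index normal subgroups of $G$. Groups are discrete; amenability is amenability as a discrete group. *)

(* Defs.v *)
From HB Require Import structures.
From mathcomp Require Import all_boot all_order all_algebra generic_quotient.
From mathcomp Require Import finmap.
From mathcomp Require Import all_classical all_reals all_analysis.

Set Implicit Arguments.
Unset Strict Implicit.
Unset Printing Implicit Defensive.

Import Order.TTheory GRing.Theory Num.Theory.

Local Open Scope fset_scope.
Local Open Scope classical_set_scope.
Local Open Scope group_scope.

(** Words in the letters x_0^{±1}, ..., x_{n-1}^{±1}; the letter [(i, true)]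
    stands for x_i^{-1} and [(i, false)] for x_i. *)
Definition letter (n : nat) : Type := ('I_n * bool)%type.

Definition inv_letter (n : nat) (a : letter n) : letter n := (a.1, ~~ a.2).

Definition word (n : nat) : Type := seq (letter n).

Definition inv_word (n : nat) (w : word n) : word n :=
  rev (map (@inv_letter n) w).

Inductive pres_eq (n : nat) (R : seq (word n)) : word n -> word n -> Prop :=
| pres_eq_refl u : pres_eq R u u
| pres_eq_sym u v : pres_eq R u v -> pres_eq R v u
| pres_eq_trans u v w : pres_eq R u v -> pres_eq R v w -> pres_eq R u w
| pres_eq_cat u u' v v' :
    pres_eq R u u' -> pres_eq R v v' -> pres_eq R (u ++ v) (u' ++ v')
| pres_eq_cancel a : pres_eq R [:: inv_letter a; a] [::]
| pres_eq_relator r : r \in R -> pres_eq R r [::].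

Definition pres_eqb (n : nat) (R : seq (word n)) : rel (word n) :=
  fun u v => `[< pres_eq R u v >].

Lemma pres_eqb_equiv (n : nat) (R : seq (word n)) :
  equiv_class_of (pres_eqb R).
Proof.
split=> [u|u v|v u w].
- by apply/asboolP; exact: pres_eq_refl.
- by apply/asboolP/asboolP; exact: pres_eq_sym.
- by move=> /asboolP uv /asboolP vw; apply/asboolP/(pres_eq_trans uv vw).
Qed.

Definition pres_equiv (n : nat) (R : seq (word n)) : equiv_rel (word n) :=
  EquivRelPack (pres_eqb_equiv R).

(** The group < x_0, ..., x_{n-1} | R >. *)
Definition presented (n : nat) (R : seq (word n)) : Type :=
  {eq_quot (pres_equiv R)}%qT.
HB.instance Definition _ (n : nat) (R : seq (word n)) :=
  Choice.on (presented R).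

Definition pres_class (n : nat) (R : seq (word n)) (w : word n) : presented R :=
  (\pi_({eq_quot (pres_equiv R)}%qT) w)%qT.

Definition pres_repr (n : nat) (R : seq (word n)) (x : presented R) : word n :=
  repr (x : {eq_quot (pres_equiv R)}%qT).

Definition pres_one (n : nat) (R : seq (word n)) : presented R :=
  pres_class R [::].

Definition pres_mul (n : nat) (R : seq (word n)) (x y : presented R) :
  presented R := pres_class R (pres_repr x ++ pres_repr y).

Definition pres_inv (n : nat) (R : seq (word n)) (x : presented R) :
  presented R := pres_class R (inv_word (pres_repr x)).

Lemma pres_reprK (n : nat) (R : seq (word n)) (x : presented R) :
  pres_class R (pres_repr x) = x.
Proof. exact: reprK. Qed.

Lemma pres_classP (n : nat) (R : seq (word n)) (u v : word n) :
  pres_class R u = pres_class R v <-> pres_eq R u v.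
Proof.
split=> [/eqP|uv].
  by rewrite /pres_class eqmodE /= => /asboolP.
by apply/eqP; rewrite /pres_class eqmodE /=; apply/asboolP.
Qed.

Lemma pres_repr_class (n : nat) (R : seq (word n)) (u : word n) :
  pres_eq R (pres_repr (pres_class R u)) u.
Proof. by apply/pres_classP; rewrite pres_reprK. Qed.

Lemma pres_class_cat (n : nat) (R : seq (word n)) (u v : word n) :
  pres_class R (u ++ v) = pres_mul (pres_class R u) (pres_class R v).
Proof.
apply/pres_classP/pres_eq_sym.
by apply: pres_eq_cat; exact: pres_repr_class.
Qed.

Lemma inv_letterK (n : nat) : involutive (@inv_letter n).
Proof. by case=> i b; rewrite /inv_letter /= negbK. Qed.

Lemma inv_wordK (n : nat) : involutive (@inv_word n).
Proof.
move=> w; rewrite /inv_word map_rev revK -map_comp -[RHS]map_id.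
by apply: eq_map => a; exact: inv_letterK.
Qed.

Lemma pres_eq_catVw (n : nat) (R : seq (word n)) (w : word n) :
  pres_eq R (inv_word w ++ w) [::].
Proof.
elim: w => [|a w IH]; first exact: pres_eq_refl.
rewrite /inv_word map_cons rev_cons cat_rcons.
apply: pres_eq_trans IH; apply: pres_eq_cat; first exact: pres_eq_refl.
rewrite -[X in pres_eq _ _ X]cat0s -[_ :: _]/([:: inv_letter a; a] ++ w).
by apply: pres_eq_cat; [exact: pres_eq_cancel | exact: pres_eq_refl].
Qed.

Lemma pres_mulA (n : nat) (R : seq (word n)) : associative (@pres_mul n R).
Proof.
move=> x y z; rewrite -(pres_reprK x) -(pres_reprK y) -(pres_reprK z).
by rewrite -!pres_class_cat catA.
Qed.

Lemma pres_mul1 (n : nat) (R : seq (word n)) :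
  left_id (pres_one R) (@pres_mul n R).
Proof. by move=> x; rewrite -(pres_reprK x) -pres_class_cat. Qed.

Lemma pres_mulr1 (n : nat) (R : seq (word n)) :
  right_id (pres_one R) (@pres_mul n R).
Proof. by move=> x; rewrite -(pres_reprK x) -pres_class_cat cats0. Qed.

Lemma pres_mulV (n : nat) (R : seq (word n)) :
  left_inverse (pres_one R) (@pres_inv n R) (@pres_mul n R).
Proof.
move=> x; rewrite -{2}(pres_reprK x) -pres_class_cat.
by apply/pres_classP; exact: pres_eq_catVw.
Qed.

Lemma pres_mulrV (n : nat) (R : seq (word n)) :
  right_inverse (pres_one R) (@pres_inv n R) (@pres_mul n R).
Proof.
move=> x; rewrite -{1}(pres_reprK x) -pres_class_cat.
apply/pres_classP; rewrite -{1}(inv_wordK (pres_repr x)).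
exact: pres_eq_catVw.
Qed.

HB.instance Definition _ (n : nat) (R : seq (word n)) :=
  isGroup.Build (presented R)
    (@pres_mulA n R) (@pres_mul1 n R) (@pres_mulr1 n R)
    (@pres_mulV n R) (@pres_mulrV n R).

Definition finitely_presented (G : groupType) : Prop :=
  exists (n : nat) (R : seq (word n)) (f : {multiplicative presented R -> G}),
    bijective f.

Definition subgroup (G : groupType) (H : set G) : Prop :=
  [/\ H 1,
      forall x y, H x -> H y -> H (x * y)
    & forall x, H x -> H x^-1].

Definition normal_subgroup (G : groupType) (N : set G) : Prop :=
  subgroup N /\ forall x g, N x -> N (x ^ g).

Definition left_translate (G : groupType) (g : G) (A : set G) : set G :=
  [set g * x | x in A].

Definition left_cosets (G : groupType) (H : set G) : set (set G) :=
  [set left_translate g H | g in [set: G]].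

Definition finite_index (G : groupType) (H : set G) : Prop :=
  finite_set (left_cosets H).

(** Only meaningful when [finite_index H] holds. *)
Definition subgroup_index (G : groupType) (H : set G) : nat :=
  #|` fset_set (left_cosets H)|.

Definition residually_finite (G : groupType) : Prop :=
  forall g : G, g <> 1 ->
    exists N : set G, [/\ normal_subgroup N, finite_index N & ~ N g].

(** Existence of a finitely additive, left-invariant probability measure
    defined on all subsets of the discrete group [G]. *)
Definition amenable (R : realType) (G : groupType) : Prop :=
  exists mu : set G -> R,
    [/\ forall A, (0 <= mu A)%R,
        mu [set: G] = 1%R,
        forall A B, A `&` B = set0 -> mu (A `|` B) = (mu A + mu B)%R
      & forall g A, mu (left_translate g A) = mu A].

Definition generated (G : groupType) (S : set G) : set G :=
  smallest (@subgroup G) S.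

(** [min_gen R H] is d(H), as an extended real; it is [+oo] exactly when the
    subgroup [H] is not finitely generated. *)
Definition min_gen (R : realType) (G : groupType) (H : set G) : \bar R :=
  ereal_inf [set (#|` S|%:R)%:E |
              S in [set S : {fset G} | generated [set` S] = H]].

Definition rank_gradient (R : realType) (G : groupType) : \bar R :=
  ereal_inf [set ((min_gen R N - 1) * ((subgroup_index N)%:R^-1)%:E)%E |
              N in [set N : set G | normal_subgroup N /\ finite_index N]].

(* Main.v *)
Require Import Defs.
From mathcomp Require Import all_boot all_order all_algebra.
From mathcomp Require Import finmap zify.
From mathcomp Require Import all_classical all_reals all_analysis.

Set Implicit Arguments.
Unset Strict Implicit.
Unset Printing Implicit Defensive.

Import Order.TTheory GRing.Theory Num.Theory.

Local Open Scope fset_scope.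
Local Open Scope classical_set_scope.
Local Open Scope group_scope.

(** Let [S] be a finite symmetric generating set of [G].  For each [k > 0] there is a
    normal subgroup [N] of finite index generated by at most [#|G / N| / k]
    elements, which gives the bound.

    By Schreier's method, a section [t] of [G -> G / N] yields the generators
    [(t (s q))^-1 * s * t q] of [N], one for each edge [q -- s q] of the Schreier
    graph of [G / N]; edges along which [t] is equivariant contribute [1] and can
    be dropped ([stabiliser_generated]).  So it suffices to find a section that
    is equivariant along most edges ([almost_equivariant_section]).

    Amenability provides a finite set [F] with few pairs [(f, s)] such that
    [s * f] leaves [F] ([folner_sets]): otherwise all finite sets expand under
    multiplication by [S], Hall's theorem gives an injection of [c.+1] copies of
    [G] into [c] copies that moves points only by elements of [S], and such a map
    contradicts the existence of an invariant mean.  Residual finiteness provides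
    an [N] modulo which all translates of [F] embed, with their internal edges.
    On one translate [F x] the section [f x |-> f * u x] is equivariant along the
    internal edges.

    To cover [G / N], tile it greedily.  For any nonempty [U] included in [G / N],
    averaging over [x] shows that some trace of [F x] on [U] is nonempty and has
    few edges to the rest of [U] ([exists_tile]).  Cutting it out and repeating
    until nothing is left, at most [#|G / N| / k] edges, up to orientation, join
    two tiles. *)

(** * Counting in finite sets *)

Lemma leq_card_fset_inj (X Y : choiceType) (f : X -> Y) (A : {fset X})
    (B : {fset Y}) :
  {in A &, injective f} -> {in A, forall x, f x \in B} -> (#|` A| <= #|` B|)%N.
Proof.
move=> f_inj fAB; have <- : #|` [fset f x | x in A]%fset| = #|` A|.
  exact: card_in_imfset.
by apply/fsubset_leq_card/fsubsetP => _ /imfsetP[x xA ->]; exact: fAB.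
Qed.

Lemma card_fsetM (X Y : choiceType) (A : {fset X}) (B : {fset Y}) :
  #|` (A `*` B)%fset| = (#|` A| * #|` B|)%N.
Proof.
rewrite -(size_allpairs pair); apply/perm_size/uniq_perm.
- exact: fset_uniq.
- by apply: allpairs_uniq => [||[a b] [a' b'] _ _ /= [-> ->]]; rewrite ?fset_uniq.
- move=> [a b]; rewrite in_fsetM /=; apply/idP/allpairsP => [/andP[aA bB]|].
    by exists (a, b).
  by move=> [[a' b'] /= [aA bB [-> ->]]]; rewrite aA.
Qed.

Lemma card_fset_filter (I : choiceType) (A : {fset I}) (P : pred I) :
  #|` [fset i in A | P i]%fset| = (\sum_(i <- A) P i)%N.
Proof.
have -> : (\sum_(i <- A) P i = count P A)%N.
  by rewrite -sum1_count [RHS]big_mkcond; apply: eq_bigr => i _; case: (P i).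
rewrite -size_filter; apply/perm_size/uniq_perm; rewrite ?fset_uniq ?filter_uniq
  ?fset_uniq//.
by move=> i; rewrite mem_filter !inE /= andbC.
Qed.

(** * Matchings in locally finite bipartite graphs *)

Definition nbhd (X Y : choiceType) (N : X -> {fset Y}) (A : {fset X}) :
  {fset Y} := (\bigcup_(x <- A) N x)%fset.

Definition hall_condition (X Y : choiceType) (N : X -> {fset Y}) : Prop :=
  forall A : {fset X}, (#|` A| <= #|` nbhd N A|)%N.

Definition remove_edge (X Y : choiceType) (N : X -> {fset Y}) (x : X) (y : Y) :
  X -> {fset Y} := fun z => if z == x then (N z `\ y)%fset else N z.

(** Recording the removed edges as one set turns the decreasing chains of graphs
    into increasing chains of sets, whose bound is a union. *)
Definition remove_edges (X Y : choiceType) (N : X -> {fset Y})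
  (E : set (X * Y)) : X -> {fset Y} :=
  fun x => [fset y in N x | ~~ `[< E (x, y) >]]%fset.

Lemma nbhdP (X Y : choiceType) (N : X -> {fset Y}) (A : {fset X}) (y : Y) :
  reflect (exists2 x, x \in A & y \in N x) (y \in nbhd N A).
Proof.
apply: (iffP (bigfcupP _ _ _ _)) => [[x /andP[xA _] yN]|[x xA yN]].
  by exists x.
by exists x; rewrite ?xA.
Qed.

Lemma nbhdS (X Y : choiceType) (N M : X -> {fset Y}) (A : {fset X}) :
  {in A, forall x, (N x `<=` M x)%fset} -> (nbhd N A `<=` nbhd M A)%fset.
Proof.
move=> NM; apply/fsubsetP => y /nbhdP[x xA yN]; apply/nbhdP.
by exists x => //; exact: (fsubsetP (NM x xA)).
Qed.

Lemma remove_edges_setU1 (X Y : choiceType) (N : X -> {fset Y})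
    (E : set (X * Y)) (x : X) (y : Y) :
  remove_edges N (E `|` [set (x, y)]) = remove_edge (remove_edges N E) x y.
Proof.
apply/funext => z; apply/fsetP => w; rewrite /remove_edge /remove_edges.
case: (eqVneq z x) => [->|zx]; rewrite !inE /=; last first.
  congr (_ && ~~ _); apply: asbool_equiv_eq.
  by split=> [[//|[zx']]|]; [rewrite zx' eqxx in zx | left].
case: (w \in N x); rewrite /= ?andbF//.
apply/idP/idP => [/asboolPn nE|/andP[wy /asboolPn nE]].
  rewrite andbC; apply/andP; split; first by apply/asboolPn => h; apply: nE; left.
  by apply/eqP => wy; apply: nE; right; rewrite wy.
by apply/asboolPn => -[//|[wy']]; rewrite wy' eqxx in wy.
Qed.

(** Two edges [x y1] and [x y2] whose removal breaks the condition are witnessed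
    by deficient sets [A1] and [A2]; as the size of a neighbourhood is
    submodular, the condition then fails for one of [x |` A1 `|` A2] and
    [A1 `&` A2]. *)
Lemma hall_minimal_degree (X Y : choiceType) (N : X -> {fset Y}) :
  hall_condition N ->
  (forall x y, y \in N x -> ~ hall_condition (remove_edge N x y)) ->
  forall x y1 y2, y1 \in N x -> y2 \in N x -> y1 = y2.
Proof.
move=> hN minN x y1 y2 y1N y2N.
have deficient y : y \in N x -> exists2 A : {fset X}, x \notin A &
    (#|` (nbhd N A `|` (N x `\ y))%fset| <= #|` A|)%N.
  move=> /minN /existsNP[A /negP]; rewrite -ltnNge => ltA.
  have xA : x \in A.
    apply/negPn/negP => xA; move: ltA; rewrite ltnNge => /negP; apply.
    apply: leq_trans (hN A) (fsubset_leq_card (nbhdS _)) => z zA.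
    rewrite /remove_edge; case: eqVneq => // zx.
    by move: xA; rewrite -zx zA.
  exists (A `\ x)%fset; first by rewrite !inE eqxx.
  rewrite -ltnS; have -> : #|` (A `\ x)%fset|.+1 = #|` A|.
    by rewrite (cardfsD1 x A) xA.
  apply: leq_trans ltA; rewrite ltnS; apply/fsubset_leq_card/fsubsetP => z.
  rewrite in_fsetU => /orP[/nbhdP[w]|zN].
    rewrite !inE => /andP[wx wA] zN; apply/nbhdP; exists w => //.
    by rewrite /remove_edge (negPf wx).
  by apply/nbhdP; exists x => //; rewrite /remove_edge eqxx.
have [A1 xA1 le1] := deficient _ y1N.
have [A2 xA2 le2] := deficient _ y2N.
apply/eqP/negPn/negP => y12.
set P1 := (_ `|` _)%fset in le1; set P2 := (_ `|` _)%fset in le2.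
have leU : (#|` A1 `|` A2|.+1 <= #|` P1 `|` P2|)%fset%N.
  have -> : (#|` A1 `|` A2|.+1 = #|` x |` (A1 `|` A2)|)%fset.
    by rewrite cardfsU1 in_fsetU negb_or xA1 xA2.
  apply: leq_trans (hN _) (fsubset_leq_card _); apply/fsubsetP => z /nbhdP[w].
  rewrite !inE => /or3P[/eqP->|wA|wA] zN.
  - by rewrite zN; case: (eqVneq z y1) => [->|_]; rewrite ?y12 /= ?orbT.
  - by apply/orP; left; apply/orP; left; apply/nbhdP; exists w.
  - by apply/orP; right; apply/orP; left; apply/nbhdP; exists w.
have leI : (#|` A1 `&` A2| <= #|` P1 `&` P2|)%fset%N.
  apply: leq_trans (hN _) (fsubset_leq_card _); apply/fsubsetP => z /nbhdP[w].
  rewrite !inE => /andP[w1 w2] zN.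
  by apply/andP; split; apply/orP; left; apply/nbhdP; exists w.
have := cardfsUI P1 P2; have := cardfsUI A1 A2; lia.
Qed.

(** This makes a condition that only looks at finitely many points at a time pass
    from the members of a chain to its union, the case of the empty chain being
    covered by [set0]. *)
Lemma chain_finite_subset (T : choiceType) (F : set (set T)) (s : seq T) :
  total_on F subset ->
  exists2 E, E = set0 \/ F E & {in s, forall p, (\bigcup_(C in F) C) p -> E p}.
Proof.
move=> totF; elim: s => [|p s [E FE sE]]; first by exists set0 => //; left.
have [[C FC Cp]|np] := pselect ((\bigcup_(C in F) C) p); last first.
  by exists E => // q; rewrite inE => /orP[/eqP->//|]; exact: sE.
case: FE => [E0|FE].
  exists C; first by right.
  move=> q; rewrite inE => /orP[/eqP->//|qs] Fq.
  by have := sE q qs Fq; rewrite E0.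
have [EC|CE] := totF _ _ FE FC.
  exists C; first by right.
  by move=> q; rewrite inE => /orP[/eqP->//|qs] Fq; exact/EC/sE.
exists E; first by right.
by move=> q; rewrite inE => /orP[/eqP->//|qs Fq]; [move=> _; exact: CE|exact: sE].
Qed.

(** Hall's theorem for a possibly infinite family of finite sets.  Finiteness
    of the neighbourhoods lets Zorn's lemma apply to the sets of edges whose
    removal preserves the condition; after removal of a maximal such set every
    vertex has exactly one neighbour. *)
Lemma hall_matching (X Y : choiceType) (N : X -> {fset Y}) :
  hall_condition N -> exists2 f : X -> Y, injective f & forall x, f x \in N x.
Proof.
move=> hN; pose P E := hall_condition (remove_edges N E).
have [|E [PE maxE]] := @Zorn_bigcup _ P.
  move=> F FP totF A.
  have [E FE AE] := chain_finite_subset (enum_fset (A `*` nbhd N A)%fset) totF.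
  have PE : (#|` A| <= #|` nbhd (remove_edges N E) A|)%N.
    case: FE => [->|/FP//]; apply: leq_trans (hN A) (fsubset_leq_card (nbhdS _)).
    by move=> x _; apply/fsubsetP => y yN; rewrite !inE /= yN; apply/asboolPn.
  apply: leq_trans PE (fsubset_leq_card (nbhdS _)) => x xA.
  apply/fsubsetP => y; rewrite !inE /= => /andP[yN /asboolPn nE].
  rewrite yN; apply/asboolPn => Fxy; apply: nE; apply: AE Fxy.
  by rewrite in_fsetM xA /=; apply/nbhdP; exists x.
have uniqN : forall x y1 y2, y1 \in remove_edges N E x ->
    y2 \in remove_edges N E x -> y1 = y2.
  apply: (hall_minimal_degree PE) => x y yN; rewrite -remove_edges_setU1.
  apply: maxE; split=> [|/(_ (x, y))]; first exact: subsetUl.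
  move: yN; rewrite !inE => /andP[_ /asboolPn nE] h.
  by apply: nE; apply: h; right.
have exN x : exists y, y \in remove_edges N E x.
  have := PE [fset x]%fset; rewrite cardfs1 cardfs_gt0 => /fset0Pn[y /nbhdP[z]].
  by rewrite inE => /eqP-> yN; exists y.
have [f fN] := choice exN.
exists f => [x1 x2 f12|x]; last by have := fN x; rewrite !inE => /andP[].
apply/eqP/negPn/negP => x12.
have := PE [fset x1; x2]%fset; rewrite cardfs2 x12 leqNgt => /negP; apply.
rewrite ltnS -[nat_of_bool true](cardfs1 (f x1)).
apply/fsubset_leq_card/fsubsetP => y /nbhdP[z].
rewrite in_fset2 in_fset1 => /orP[]/eqP-> yN; apply/eqP.
  exact: uniqN yN (fN x1).
by rewrite f12; exact: uniqN yN (fN x2).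
Qed.

(** * Følner sets *)

Lemma finitely_additive_sum (R : realType) (T : Type) (K : finType)
    (mu : set T -> R) (A : K -> set T) :
  (forall B C, B `&` C = set0 -> mu (B `|` C) = (mu B + mu C)%R) ->
  (forall k l x, A k x -> A l x -> k = l) ->
  mu (\bigcup_k A k) = (\sum_(k : K) mu (A k))%R.
Proof.
move=> addmu disjA.
have mu0 : mu set0 = 0%R.
  by apply: (@addrI _ (mu set0)); rewrite addr0 -addmu ?setU0 ?setI0.
have sum_seq (s : seq K) : uniq s ->
    mu [set x | exists2 k, k \in s & A k x] = (\sum_(k <- s) mu (A k))%R.
  elim: s => [_|k s IH /= /andP[ks us]].
    rewrite big_nil -mu0; congr mu; rewrite eqEsubset.
    by split=> x //= -[k]; rewrite in_nil.
  rewrite big_cons -IH// -addmu; last first.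
    rewrite eqEsubset; split=> x // -[Akx [l ls Alx]].
    by move: ks; rewrite (disjA _ _ _ Akx Alx) ls.
  congr mu; rewrite eqEsubset; split=> x /=.
    by move=> [l]; rewrite inE => /orP[/eqP->|ls] Alx; [left | right; exists l].
  by move=> [Akx|[l ls Alx]]; [exists k | exists l]; rewrite ?inE ?eqxx ?ls ?orbT.
rewrite -big_enum /= -sum_seq ?enum_uniq//; congr mu; rewrite eqEsubset.
by split=> x /= [k _ Akx]; exists k; rewrite ?mem_enum.
Qed.

Definition boundary (G : groupType) (S F : {fset G}) : {fset G * G} :=
  [fset p in (F `*` S)%fset | p.2 * p.1 \notin F]%fset.

(** Integrate: the [c.+1] copies of [G] have total mass [c.+1], and [phi] cuts
    them into finitely many pieces whose translates fit disjointly into the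
    [c] copies on the right, of total mass [c]. *)
Lemma amenable_no_contraction (R : realType) (G : groupType) (S : {fset G})
    (c : nat) (phi : G * 'I_c.+1 -> G * 'I_c) :
  amenable R G -> injective phi ->
  ~ forall p, (phi p).1 * p.1^-1 \in S.
Proof.
move=> [mu [mu_ge0 mu1 addmu invmu]] phi_inj phiS.
pose A (i : 'I_c.+1) (s : S) (j : 'I_c) : set G :=
  [set g | phi (g, i) = (val s * g, j)].
have mu_le1 B : (mu B <= 1)%R.
  by rewrite -mu1 -(setUv B) addmu ?setICr// lerDl.
have total i : (\sum_(k : S * 'I_c) mu (A i k.1 k.2) = 1)%R.
  rewrite -(@finitely_additive_sum R G _ mu (fun k : S * 'I_c => A i k.1 k.2))//.
    rewrite -mu1; congr mu; rewrite eqEsubset; split=> g // _.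
    have gS := phiS (g, i).
    exists ([` gS]%fset, (phi (g, i)).2) => //=.
    by rewrite /A /= mulgVK -surjective_pairing.
  move=> [s j] [s' j'] g; rewrite /A /= => -> [/mulIg ss' ->].
  by congr (_, _); exact: val_inj.
have packed j : (\sum_(k : 'I_c.+1 * S) mu (A k.1 k.2 j) <= 1)%R.
  under eq_bigr => k _ do rewrite -(invmu (val k.2)).
  rewrite -(@finitely_additive_sum R G _ mu
    (fun k : 'I_c.+1 * S => left_translate (val k.2) (A k.1 k.2 j)))//.
  move=> [i s] [i' s'] x [g Ag gx] [g' Ag' gx'].
  have /phi_inj[gg' ii'] : phi (g, i) = phi (g', i').
    by move: Ag Ag'; rewrite /A /= => -> ->; rewrite gx gx'.
  congr (_, _) => //; apply: val_inj; apply: (@mulIg _ g).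
  by rewrite gx -gx' gg'.
have : (\sum_(i < c.+1) \sum_(k : S * 'I_c) mu (A i k.1 k.2) =
        \sum_(j < c) \sum_(k : 'I_c.+1 * S) mu (A k.1 k.2 j))%R.
  rewrite pair_big /= [RHS]pair_big /=.
  pose h (q : 'I_c * ('I_c.+1 * S)) : 'I_c.+1 * (S * 'I_c) :=
    (q.2.1, (q.2.2, q.1)).
  rewrite (reindex h)//; exists (fun q => (q.2.2, (q.1, q.2.1))).
    by move=> [j [i s]].
  by move=> [i [s j]].
under eq_bigr => i _ do rewrite total.
rewrite sumr_const card_ord => eq_c.
have : (c.+1%:R <= c%:R :> R)%R.
  have -> : (c%:R = \sum_(j < c) 1 :> R)%R by rewrite sumr_const card_ord.
  by rewrite eq_c; apply: ler_sum => j _; exact: packed.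
by rewrite ler_nat ltnn.
Qed.

Definition fset_mul (G : groupType) (S F : {fset G}) : {fset G} :=
  [fset s * f | s in S, f in F]%fset.

(** If all finite sets had a large boundary, multiplication by [S] would expand
    them by a factor [c.+1 / c], and Hall's theorem would produce the map
    excluded by [amenable_no_contraction].  Comparing [c.+1] with [c] copies of
    [G] uses this factor as it is, without iterating it to reach 2. *)
Lemma folner_sets (R : realType) (G : groupType) (S : {fset G}) (k : nat) :
  amenable R G -> 1 \in S ->
  exists2 F : {fset G}, F != fset0 & (k * #|` boundary S F| <= #|` F|)%N.
Proof.
move=> amG S1; apply: contrapT => noF.
have largeB (F : {fset G}) : F != fset0 -> (#|` F| < k * #|` boundary S F|)%N.
  by move=> F0; rewrite ltnNge; apply/negP => h; apply: noF; exists F.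
(* [boundary] counts pairs, and an element outside [F] lies in at most [#|S|] of
   them; hence the factor [#|S|]. *)
pose c := (k * #|` S|)%N.
have expand (F : {fset G}) : (#|` F| * c.+1 <= #|` fset_mul S F| * c)%N.
  have [->|F0] := eqVneq F fset0; first by rewrite cardfs0.
  have FSF : (F `<=` fset_mul S F)%fset.
    apply/fsubsetP => f fF; apply/imfset2P.
    by exists 1 => //; exists f; rewrite ?mul1g.
  have leB : (#|` boundary S F| <= #|` fset_mul S F `\` F| * #|` S|)%fset%N.
    rewrite -card_fsetM.
    apply: (@leq_card_fset_inj _ _ (fun p => (p.2 * p.1, p.2))).
      by move=> [f s] [f' s'] _ _ [/= + ss']; rewrite ss' => /mulgI->.
    move=> [f s]; rewrite !inE /= => /andP[/andP[fF sS] sfF].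
    by rewrite sfF sS /= andbT; apply/imfset2P; exists s => //; exists f.
  have := largeB F F0; have := cardfsDS FSF; have := fsubset_leq_card FSF.
  rewrite /c => le1 eq2 lt3.
  have : (#|` F| <= #|` fset_mul S F `\` F|%fset * (k * #|` S|))%N.
    apply: leq_trans (ltnW lt3) _; rewrite mulnCA leq_mul2l.
    by rewrite leB orbT.
  rewrite eq2 mulnBl mulnS; lia.
have card_ords n : #|` [fset j in 'I_n]%fset| = n.
  by rewrite card_imfset//= -cardE card_ord.
pose N (p : G * 'I_c.+1) : {fset G * 'I_c} :=
  (fset_mul S [fset p.1] `*` [fset j in 'I_c])%fset.
have [A|phi phi_inj phiN] := @hall_matching _ _ N.
  pose B := [fset p.1 | p in A]%fset.
  have leA : (#|` A| <= #|` B| * c.+1)%N.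
    rewrite -[X in (_ <= _ * X)%N](card_ords c.+1) -card_fsetM.
    apply/fsubset_leq_card/fsubsetP => p pA.
    by rewrite !inE /= andbT; apply/imfsetP; exists p.
  apply: leq_trans leA (leq_trans (expand B) _).
  rewrite -[X in (_ * X <= _)%N](card_ords c) -card_fsetM.
  apply/fsubset_leq_card/fsubsetP => -[x j].
  rewrite in_fsetM /= => /andP[/imfset2P[s sS [f /imfsetP[p pA ->] ->]] _].
  apply/nbhdP; exists p => //; rewrite in_fsetM !inE /= andbT.
  by apply/imfset2P; exists s => //; exists p.1; rewrite ?inE.
apply: (amenable_no_contraction amG phi_inj (S := S)) => p.
have := phiN p; rewrite in_fsetM => /andP[/imfset2P[s sS [g]] + + _].
by rewrite !inE => /eqP-> ->; rewrite mulgK.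
Qed.

(** * Tiling finite [G]-sets *)

Section FiniteGSet.
Variables (G : groupType) (T : finType) (act : G -> T -> T).
Hypothesis act1 : forall x, act 1 x = x.
Hypothesis actM : forall g h x, act (g * h) x = act g (act h x).

Lemma actK g : cancel (act g) (act g^-1).
Proof. by move=> x; rewrite -actM mulVg act1. Qed.

Lemma actVK g : cancel (act g^-1) (act g).
Proof. by move=> x; rewrite -actM mulgV act1. Qed.

Lemma sum_card_preim (I : choiceType) (A : {fset I}) (h : I -> G)
    (U : {set T}) :
  (\sum_(x : T) #|` [fset i in A | act (h i) x \in U]%fset| =
   #|` A| * #|U|)%N.
Proof.
under eq_bigr => x _ do rewrite card_fset_filter.
rewrite exchange_big /=; under eq_bigr => i _.
  rewrite -big_mkcond sum1_card.
  have -> : #|[pred x | act (h i) x \in U]| = #|U|.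
    rewrite -(card_preimset U (can_inj (actK (h i)))).
    by apply: eq_card => x; rewrite !inE.
  over.
by rewrite big_const_seq count_predT iter_addn_0 mulnC.
Qed.

(** As [act f] is a bijection, summing over all [x] turns the two counts into
    [#|F| * #|U|] and [#|boundary S F| * #|U|], so the wanted inequality holds on
    average; some [x] satisfies it with a nonempty trace because the first sum
    is positive. *)
Lemma exists_tile (S F : {fset G}) (k : nat) (U : {set T}) :
  F != fset0 -> (k * #|` boundary S F| <= #|` F|)%N -> U != finset.set0 ->
  exists2 x, (0 < #|` [fset f in F | act f x \in U]%fset|)%N &
    (k * #|` [fset p in boundary S F | act p.1 x \in U]%fset| <=
     #|` [fset f in F | act f x \in U]%fset|)%N.
Proof.
move=> F0 kF U0.
pose a x := #|` [fset f in F | act f x \in U]%fset|.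
pose b x := #|` [fset p in boundary S F | act p.1 x \in U]%fset|.
have sum_a : (\sum_x a x = #|` F| * #|U|)%N := sum_card_preim F id U.
have sum_b : (\sum_x b x = #|` boundary S F| * #|U|)%N := sum_card_preim _ fst U.
apply: contrapT => no_tile.
have bad x : (a x + (0 < a x) <= k * b x)%N.
  have [->//|a_gt0] := posnP (a x); rewrite addn1 ltnNge; apply/negP => le_ba.
  by apply: no_tile; exists x.
have : (\sum_x a x + \sum_x (0 < a x) <= k * \sum_x b x)%N.
  by rewrite -big_split big_distrr /=; apply: leq_sum => x _.
have lt0 : (0 < \sum_x a x)%N by rewrite sum_a muln_gt0 cardfs_gt0 F0 card_gt0.
have : (0 < \sum_x (0 < a x))%N.
  rewrite lt0n; apply/eqP => /eqP; rewrite sum_nat_eq0 => /forallP no_a.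
  move: lt0; rewrite big1// => x _; have := no_a x; rewrite implyTb.
  by case: (a x).
have : (k * \sum_x b x <= \sum_x a x)%N.
  by rewrite sum_a sum_b mulnA leq_mul2r kF orbT.
lia.
Qed.

(** Greedy tiling: cut out of [U] the trace of a translate [F x] with few
    outgoing edges, and continue with the rest.  Every edge inside [U] that joins
    two tiles is charged to the tile cut out first, which is why [B] is
    consulted at both of its ends.  On the tile at [x] the section is
    [act f x |-> f * u x]; [free] makes this well defined and equivariant. *)
Lemma almost_equivariant_section (S F : {fset G}) (k : nat) (x0 : T)
    (u : T -> G) :
  1 \in S -> (forall s, s \in S -> s^-1 \in S) ->
  F != fset0 -> (k * #|` boundary S F| <= #|` F|)%N ->
  (forall s f f' x, s \in S -> f \in F -> f' \in F ->
     act (s * f) x = act f' x -> s * f = f') ->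
  (forall x, act (u x) x0 = x) ->
  forall U : {set T}, exists (t : T -> G) (B : {fset T * G}),
  [/\ (k * #|` B| <= #|U|)%N,
      forall x, act (t x) x0 = x
    & forall x s, s \in S -> x \in U -> act s x \in U ->
        [\/ t (act s x) = s * t x, (x, s) \in B | (act s x, s^-1) \in B]].
Proof.
move=> S1 SV F0 kF free uK U.
have [n] := ubnP #|U|; elim: n U => // n IH U leUn.
have [->|U0] := eqVneq U finset.set0.
  by exists u, fset0; split=> // [|x s _]; rewrite ?cardfs0 ?muln0// inE.
have [x a_gt0 le_ba] := exists_tile F0 kF U0.
set a := [fset f in F | _]%fset in a_gt0 le_ba.
set b := [fset p in boundary S F | _]%fset in le_ba.
have injF f f' : f \in F -> f' \in F -> act f x = act f' x -> f = f'.
  by move=> fF f'F ff'; rewrite -(mul1g f) (free 1 f f' x)// mul1g.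
pose tile : {set T} := [set y in U | `[< exists2 f, f \in F & act f x = y >]].
have tileP y : reflect (y \in U /\ exists2 f, f \in F & act f x = y)
                       (y \in tile).
  by rewrite inE; apply: (iffP andP) => -[yU /asboolP h].
have card_tile : #|tile| = #|` a|.
  have <- : #|` [fset act f x | f in a]%fset| = #|` a|.
    apply: card_in_imfset => f f'; rewrite !inE /= => /andP[fF _] /andP[f'F _].
    exact: injF.
  rewrite cardE; apply/perm_size/uniq_perm; rewrite ?enum_uniq ?fset_uniq//.
  move=> y; rewrite mem_enum; apply/tileP/imfsetP => [[yU [f fF fy]]|[f]].
    by exists f; rewrite // !inE /= fF fy.
  by rewrite !inE /= => /andP[fF fU] ->; split=> //; exists f.
have tileU : tile \subset U by apply/fintype.subsetP => y /tileP[].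
have cardU : (#|U :\: tile| + #|tile| = #|U|)%N.
  by rewrite addnC -(cardsID tile U) (finset.setIidPr tileU).
have [|t [B [leB tK tB]]] := IH (U :\: tile).
  by rewrite -ltnS; apply: leq_trans leUn; rewrite -cardU card_tile; lia.
pose lab y := xget 1 [set f | f \in F /\ act f x = y].
have labE f : f \in F -> lab (act f x) = f.
  move=> fF; rewrite /lab; case: xgetP => [f' _ [f'F /injF ->//]|no_f].
  by have := no_f f; case.
pose t' y := if y \in tile then lab y * u x else t y.
pose C := [fset (act p.1 x, p.2) | p in b]%fset.
exists t', (B `|` C)%fset; split.
- have leC : (k * #|` C| <= #|tile|)%N.
    rewrite card_tile; apply: leq_trans le_ba.
    by rewrite leq_mul2l leq_imfset_card orbT.
  have := cardfsUI B C; rewrite -cardU; nia.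
- move=> y; rewrite /t'; case: tileP => [[_ [f fF <-]]|_]; last exact: tK.
  by rewrite labE// actM uK.
(* An edge leaving the tile at [act f x] has [s * f] outside [F]. *)
have leaving y s : s \in S -> y \in tile -> act s y \in U ->
    act s y \notin tile -> (y, s) \in C.
  move=> sS yT syU syT; have [yU [f fF fy]] := tileP _ yT.
  apply/imfsetP; exists (f, s); last by rewrite /= fy.
  rewrite !inE /= fF sS fy yU andbT /=; apply: contra syT => sfF.
  by apply/tileP; split=> //; exists (s * f) => //; rewrite actM fy.
move=> y s sS yU syU; rewrite !in_fsetU /t'.
have [yT|yT] := boolP (y \in tile); have [syT|syT] := boolP (act s y \in tile).
- have [_ [f fF fy]] := tileP _ yT; have [_ [f' f'F f'y]] := tileP _ syT.
  apply: Or31; rewrite -f'y -fy !labE// mulgA (free s f f' x)//.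
  by rewrite actM fy.
- by apply: Or32; rewrite leaving// orbT.
- by apply: Or33; rewrite leaving ?SV ?actK ?orbT.
- have [||e|e|e] := tB y s sS; rewrite ?finset.in_setD ?yT ?syT//.
  + exact: Or31.
  + by apply: Or32; rewrite e.
  + by apply: Or33; rewrite e.
Qed.

End FiniteGSet.

(** * Schreier generators *)

Lemma subgroup_generated (G : groupType) (S : set G) : subgroup (generated S).
Proof.
split=> [H [[]]//|x y Sx Sy H HS|x Sx H HS]; case: (HS) => -[_ HM HV] _.
  by apply: HM; [exact: Sx | exact: Sy].
by apply: HV; exact: Sx.
Qed.

(** Let [H] be the subgroup generated by the listed elements.  The [g] such that
    [(t (act g x))^-1 * g * t x] lies in [H] for every [x] form a subgroup; it
    contains [S], hence is [G].  For [g] in the stabiliser and [x = x0] this says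
    that [H] contains [(t x0)^-1 * g * t x0], and [t x0] itself stabilises [x0], so
    all of the stabiliser arises in this way. *)
Lemma stabiliser_generated (G : groupType) (T : finType) (act : G -> T -> T)
    (S : {fset G}) (x0 : T) (t : T -> G) (B : {fset T * G}) :
  (forall x, act 1 x = x) ->
  (forall g h x, act (g * h) x = act g (act h x)) ->
  generated [set` S] = setT ->
  (forall x, act (t x) x0 = x) ->
  (forall x s, s \in S ->
     [\/ t (act s x) = s * t x, (x, s) \in B | (act s x, s^-1) \in B]) ->
  generated [set` [fset (t (act p.2 p.1))^-1 * p.2 * t p.1 | p in B]%fset] =
  [set g | act g x0 = x0].
Proof.
move=> act1 actM genS tK tB; set W := [fset _ | p in B]%fset.
have tV x : act (t x)^-1 x = x0 by rewrite -{2}(tK x) actK.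
have [H1 HM HV] := subgroup_generated [set` W].
rewrite eqEsubset; split.
  apply: smallest_sub => [|_ /imfsetP[[x s] xsB ->]] /=.
    split=> [|g h /= gx hx|g /= gx]; first exact: act1.
      by rewrite actM hx.
    by rewrite -{1}gx actK.
  by rewrite !actM tK tV.
have WH p : p \in B -> generated [set` W] ((t (act p.2 p.1))^-1 * p.2 * t p.1).
  by move=> pB; apply: sub_gen_smallest => /=; apply/imfsetP; exists p.
pose K := [set g | forall x, generated [set` W] ((t (act g x))^-1 * g * t x)].
have KT : generated [set` S] `<=` K.
  apply: smallest_sub => [|s /= sS x].
    split=> [x|g h Kg Kh x|g Kg x].
    - by rewrite act1 mulg1 mulVg.
    - have := HM _ _ (Kg (act h x)) (Kh x); rewrite actM.
      by rewrite !mulgA mulgK.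
    - have := HV _ (Kg (act g^-1 x)); rewrite actVK//.
      by rewrite !invgM invgK mulgA.
  have [->|xsB|xsB] := tB x s sS.
  - by rewrite invgM mulgVK mulVg.
  - exact: WH xsB.
  - have := HV _ (WH _ xsB); rewrite /= actK//.
    by rewrite !invgM !invgK mulgA.
move=> g /= gx0.
(* This conjugate of [g] also fixes [x0], and [K] at [x0] turns it back into [g]. *)
have : K (t x0 * g * (t x0)^-1) by apply: KT; rewrite genS.
by move=> /(_ x0); rewrite !actM tV gx0 tK !mulgA mulVg mul1g mulgVK.
Qed.

(** * Finite-index normal subgroups *)

Lemma left_translateM (G : groupType) (g h : G) (A : set G) :
  left_translate (g * h) A = left_translate g (left_translate h A).
Proof.
rewrite eqEsubset; split=> [_ [x Ax <-]|_ [_ [x Ax <-] <-]].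
  by exists (h * x); [exists x | rewrite mulgA].
by exists x; rewrite ?mulgA.
Qed.

Lemma left_translate1 (G : groupType) (A : set G) : left_translate 1 A = A.
Proof.
rewrite eqEsubset; split=> [_ [x Ax <-]|x Ax]; first by rewrite mul1g.
by exists x; rewrite ?mul1g.
Qed.

Lemma left_translate_id (G : groupType) (N : set G) (g : G) :
  subgroup N -> left_translate g N = N <-> N g.
Proof.
move=> [N1 NM NV]; split=> [gN|Ng].
  by rewrite -gN; exists 1; rewrite ?mulg1.
rewrite eqEsubset; split=> [_ [x Nx <-]|x Nx]; first exact: NM.
by exists (g^-1 * x); [apply/NM/Nx/NV | rewrite mulVKg].
Qed.

Lemma finite_indexI (G : groupType) (N M : set G) :
  finite_index N -> finite_index M -> finite_index (N `&` M).
Proof.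
move=> fN fM.
apply: (@sub_finite_set _ _
  [set p.1 `&` p.2 | p in left_cosets N `*` left_cosets M]); last first.
  exact/finite_image/finite_setX.
move=> _ [g _ <-]; exists (left_translate g N, left_translate g M).
  by split; exists g.
rewrite /= eqEsubset; split=> [_ [[x Nx <-] [y My]] /mulgI yx|_ [x [Nx Mx] <-]].
  by exists x => //; split=> //; rewrite -yx.
by split; exists x.
Qed.

Lemma normal_subgroupI (G : groupType) (N M : set G) :
  normal_subgroup N -> normal_subgroup M -> normal_subgroup (N `&` M).
Proof.
move=> [[N1 NM NV] NJ] [[M1 MM MV] MJ]; split=> [|x g [Nx Mx]].
  split=> [//|x y [Nx Mx] [Ny My]|x [Nx Mx]].
    by split; [exact: NM | exact: MM].
  by split; [exact: NV | exact: MV].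
by split; [exact: NJ | exact: MJ].
Qed.

Lemma residually_finite_seq (G : groupType) (E : seq G) :
  residually_finite G -> exists N : set G,
    [/\ normal_subgroup N, finite_index N & {in E, forall e, N e -> e = 1}].
Proof.
move=> rfG; elim: E => [|e E [N [nN fN NE]]].
  exists setT; split=> //; apply: (@sub_finite_set _ _ [set setT]) => //.
  move=> _ [g _ <-]; rewrite /= eqEsubset; split=> // x _.
  by exists (g^-1 * x); rewrite ?mulVKg.
have [->|/eqP e1] := eqVneq e 1.
  by exists N; split=> // x; rewrite inE => /orP[/eqP->|/NE].
have [M [nM fM Me]] := rfG e e1.
exists (N `&` M); split; [exact: normal_subgroupI|exact: finite_indexI|].
by move=> x; rewrite inE => /orP[/eqP-> [_ /Me]|/NE h [/h]].
Qed.

(** The stabiliser of the coset [N] in the [G]-set of left cosets is [N].  If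
    [N] meets the finitely many products [f'^-1 * (s * f)] trivially, then, [N]
    being normal, every translate of a Følner set [F] embeds in this [G]-set
    together with its internal edges.  So the stabiliser of [N] is generated by
    the few edges between the tiles. *)
Lemma normal_subgroup_few_generators (R : realType) (G : groupType)
    (S : {fset G}) (k : nat) :
  1 \in S -> (forall s, s \in S -> s^-1 \in S) ->
  generated [set` S] = setT -> residually_finite G -> amenable R G ->
  exists N : set G, [/\ normal_subgroup N, finite_index N &
    exists2 W : {fset G}, generated [set` W] = N &
      (k * #|` W| <= subgroup_index N)%N].
Proof.
move=> S1 SV genS rfG amG.
have [F F0 kF] := folner_sets k amG S1.
pose E := [seq p.1.2^-1 * (p.2 * p.1.1) | p <- enum_fset ((F `*` F) `*` S)%fset].
have [N [nN fN NE]] := residually_finite_seq E rfG.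
have sN : subgroup N by case: nN.
exists N; split=> //.
pose T : finType := fset_set (left_cosets N).
have memT (A : set G) : left_cosets N A -> A \in fset_set (left_cosets N).
  by move=> NA; rewrite in_fset_set// inE.
have cosetT (A : T) : left_cosets N (val A).
  by have := valP A; rewrite in_fset_set// inE.
have act_mem g (A : T) : left_translate g (val A) \in fset_set (left_cosets N).
  apply: memT; have [h _ <-] := cosetT A.
  by exists (g * h); rewrite ?left_translateM.
pose act g (A : T) : T := [` act_mem g A]%fset.
have act1 A : act 1 A = A by apply: val_inj; rewrite /= left_translate1.
have actM g h A : act (g * h) A = act g (act h A).
  by apply: val_inj; rewrite /= left_translateM.
have memN : N \in fset_set (left_cosets N).
  by apply: memT; exists 1; rewrite ?left_translate1.
pose x0 : T := [` memN]%fset.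
have /choice[u uK] (A : T) : exists g, act g x0 = A.
  by have [g _ gA] := cosetT A; exists g; apply: val_inj.
have free s f f' (A : T) : s \in S -> f \in F -> f' \in F ->
    act (s * f) A = act f' A -> s * f = f'.
  move=> sS fF f'F; rewrite -{1 2}(uK A) -!actM => eq_sf.
  have : act ((f' * u A)^-1 * (s * f * u A)) x0 = x0.
    by rewrite actM eq_sf -actM mulVg act1.
  move=> /(congr1 val) /= /(left_translate_id _ sN) Nsf.
  have [_ NJ] := nN; have {Nsf} := NJ _ (u A)^-1 Nsf.
  rewrite conjgE invgK invgM !mulgA mulgV mul1g mulgK -mulgA => Ne.
  have/mulg1_eq : f'^-1 * (s * f) = 1.
    apply: NE Ne; apply/mapP; exists ((f, f'), s) => //.
    by rewrite !in_fsetM /= fF f'F.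
  by rewrite invgK.
have [t [B [kB tK tB]]] :=
  almost_equivariant_section act1 actM S1 SV F0 kF free uK [set: T]%SET.
exists [fset (t (act p.2 p.1))^-1 * p.2 * t p.1 | p in B]%fset.
  rewrite (@stabiliser_generated _ T act S x0)//; last first.
    by move=> A s sS; apply: tB; rewrite ?inE.
  rewrite eqEsubset; split=> g /=.
    by move=> /(congr1 val) /= /(left_translate_id _ sN).
  by move=> /(left_translate_id _ sN) gN; apply: val_inj.
rewrite cardsT in kB.
have -> : subgroup_index N = #|T| by rewrite /subgroup_index /T cardfE.
by apply: leq_trans kB; rewrite leq_mul2l leq_imfset_card orbT.
Qed.

(** * The rank gradient *)

Lemma finitely_presented_generated (G : groupType) :
  finitely_presented G -> exists S : {fset G},
    [/\ 1 \in S, forall s, s \in S -> s^-1 \in S & generated [set` S] = setT].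
Proof.
move=> [n [R [f [f' _ f'K]]]].
have f1 : f 1 = 1 by apply: (@mulgI _ (f 1)); rewrite -gmulfM !mulg1.
pose gen (a : letter n) : G := f (pres_class R [:: a]).
have genV a : gen (inv_letter a) = (gen a)^-1.
  apply/esym/invg_inj; rewrite invgK; apply/esym/mulg1_eq.
  rewrite -gmulfM -[_ * _]pres_class_cat -f1; congr (f _).
  exact/pres_classP/pres_eq_cancel.
pose S := (1 |` [fset gen a | a : ('I_n * bool)%type])%fset.
have genS a : gen a \in S.
  by rewrite !inE; apply/orP; right; apply/imfsetP; exists a.
exists S; split=> [|s|].
- by rewrite !inE eqxx.
- rewrite in_fset1U => /orP[/eqP->|/imfsetP[a _ ->]]; last by rewrite -genV genS.
  by rewrite invg1 !inE eqxx.
rewrite eqEsubset; split=> // g _.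
have [H1 HM _] := subgroup_generated [set` S].
rewrite -(f'K g) -(pres_reprK (f' g)); elim: (pres_repr _) => [|a w IH].
  by rewrite -[pres_class R [::]]/(1 : presented R) f1.
have -> : pres_class R (a :: w) = pres_class R [:: a] * pres_class R w :=
  pres_class_cat R [:: a] w.
rewrite gmulfM.
by apply: HM IH; apply: sub_gen_smallest; exact: genS.
Qed.

Theorem theorem1p2 (R : realType) (G : groupType)
    (hfp : finitely_presented G) (hrf : residually_finite G)
    (ham : amenable R G) :
  (rank_gradient R G <= 0)%E.
Proof.
have [S [S1 SV genS]] := finitely_presented_generated hfp.
apply/lee_addgt0Pr => e e_gt0; rewrite add0e.
have [k] := ltr_add_invr e_gt0; rewrite add0r => lt_ke.
have [N [nN fN [W genW leW]]] :=
  normal_subgroup_few_generators k.+1 S1 SV genS hrf ham.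
have le_min : (min_gen R N <= (#|` W|%:R)%:E)%E.
  by apply: ereal_inf_lbound; exists W.
apply: (@le_trans _ _
  ((min_gen R N - 1) * ((subgroup_index N)%:R^-1)%:E)%E).
  by apply: ereal_inf_lbound; exists N.
apply: (@le_trans _ _ ((#|` W|%:R)%:E * ((subgroup_index N)%:R^-1)%:E)%E).
  apply: lee_wpmul2r; first by rewrite lee_fin invr_ge0.
  by apply: le_trans le_min; rewrite leeBlDr// leeDl.
rewrite -EFinM lee_fin; apply: le_trans (ltW lt_ke).
have [->|idx_gt0] := posnP (subgroup_index N); first by rewrite invr0 mulr0.
rewrite ler_pdivrMr ?ltr0n// mulrC ler_pdivlMr ?ltr0n//.
by rewrite -natrM ler_nat mulnC.
Qed.
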